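(* There is a CLI Polish group $G$ and a Polish $G$-space $X$ which is turbulent and generically unbalanced.
   Context: A Polish group is CLI if it admits a compatible complete left-invariant metric. A Polish $G$-space is a Polish space $X$ with a continuous left action of the Polish group $G$; $[x]=Gx$ denotes the orbit of $x$. Turbulence (Hjorth): for $x\in X$, open $U\ni x$ and an open symmetric neighborhood $V$ of the identity of $G$, the local orbit $O(x,U,V)$ is the set of all $y\in U$ for which there are $k\ge 0$, $g_0,\dots,g_{k-1}\in V$ and $x=x_0,\dots,x_k=y$ in $U$ with $x_{i+1}=g_ix_i$ for $i<k$. The Polish $G$-space $X$ is turbulent if every orbit is dense and meager and every local orbit $O(x,U,V)$ is somewhere dense. For $x,y\in X$ write $x\leftrightsquigarrow y$ if for every open neighborhood $V$ of the identity of $G$ and every open $U\subseteq X$ having nonempty intersection with the orbit of $x$ or with the orbit of $y$, there exist $g^x,g^y\in G$ with $g^xx\in U$ and $g^yy\in U$ such that $g^yy\in\overline{V(g^xx)}$ and $g^xx\in\overline{V(g^yy)}$. This is symmetric and invariant under the action in each variable, so one writes $[x]\leftrightsquigarrow[y]$ when $x\leftrightsquigarrow y$. For a $G$-invariant $C\subseteq X$, let $C/G=\{[x]: x\in C\}$. A path in $C/G$ from $[x]$ to $[y]$ is a sequence $x_0,\dots,x_{n-1}\in C$ with $x_0=x$, $x_{n-1}=y$ and $x_{i-1}\leftrightsquigarrow x_i$ for all $0<i<n$. $(X/G,\leftrightsquigarrow)$ is generically semi-connected if for every $G$-invariant comeager $C\subseteq X$ there is a comeager $D\subseteq C$ such that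 for all $x,y\in D$ there is a path between $[x]$ and $[y]$ in $(C/G,\leftrightsquigarrow)$. $X$ is generically unbalanced if all its orbits are meager and $(X/G,\leftrightsquigarrow)$ is generically semi-connected. *)

(* Defs.v *)
From HB Require Import structures.
From mathcomp Require Import all_boot all_order all_algebra.
From mathcomp Require Import all_classical all_reals all_analysis.

Set Implicit Arguments.
Unset Strict Implicit.
Unset Printing Implicit Defensive.

Import Order.TTheory GRing.Theory Num.Theory.

Local Open Scope classical_set_scope.
Local Open Scope group_scope.

HB.structure Definition PreTopologicalGroup := {G of Topological G & Group G}.

HB.mixin Record PreTopologicalGroup_isTopologicalGroup G
    of PreTopologicalGroup G := {
  mulg_continuous : continuous (fun p : G * G => p.1 * p.2) ;
  invg_continuous : continuous (fun g : G => g^-1)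
}.

#[short(type="topologicalGroupType")]
HB.structure Definition TopologicalGroup :=
  {G of PreTopologicalGroup G & PreTopologicalGroup_isTopologicalGroup G}.

Section Polish.
Local Open Scope ring_scope.
Context (R : realType) (T : topologicalType).
Implicit Type d : T -> T -> R.

Definition is_metric d :=
  [/\ forall x y, 0 <= d x y,
      forall x y, d x y = 0 <-> x = y,
      forall x y, d x y = d y x &
      forall x y z, d x z <= d x y + d y z].

Definition compatible_metric d :=
  is_metric d /\
  forall A : set T, open A <->
    forall x, A x -> exists2 e : R, 0 < e & [set y | d x y < e] `<=` A.

Definition cauchy_seq d (u : nat -> T) :=
  forall e : R, 0 < e ->
    exists N : nat, forall m n : nat, (N <= m)%N -> (N <= n)%N -> d (u m) (u n) < e.

(* For compatible [d], convergence in the topology of [T] is convergence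
   for [d]. *)
Definition complete_metric d :=
  forall u : nat -> T, cauchy_seq d u -> exists l : T, u @ \oo --> l.

Definition separable_space := exists2 D : set T, countable D & dense D.

(* The empty space is not excluded here. *)
Definition polish_space :=
  separable_space /\ exists d, compatible_metric d /\ complete_metric d.

End Polish.

Section Groups.
Context (R : realType) (G : topologicalGroupType).

Definition polish_group := polish_space R G.

Definition left_invariant (d : G -> G -> R) :=
  forall g h k : G, d (g * h) (g * k) = d h k.

Definition CLI :=
  exists d : G -> G -> R,
    [/\ compatible_metric d, complete_metric d & left_invariant d].

End Groups.

Section Category.
Context (T : topologicalType).
Implicit Type A : set T.

Definition somewhere_dense A := (closure A)° !=set0.

Definition nowhere_dense A := (closure A)° = set0.

Definition meager A :=
  exists2 F : nat -> set T, forall n, nowhere_dense (F n) & A = \bigcup_n F n.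

Definition comeager A := meager (~` A).

End Category.

Section Actions.
Context (G : topologicalGroupType) (X : topologicalType) (act : G -> X -> X).
Implicit Types (x y : X) (U C : set X) (V : set G).

Definition left_action :=
  (forall x, act 1 x = x) /\
  (forall g h x, act (g * h) x = act g (act h x)).

Definition polish_Gspace (R : realType) :=
  [/\ polish_group R G, polish_space R X, left_action &
      continuous (fun p : G * X => act p.1 p.2)].

Definition Gorbit x : set X := [set act g x | g in [set: G]].

Definition Ginvariant C := forall g x, C x -> C (act g x).

Definition local_orbit x U V : set X :=
  [set y | exists (k : nat) (g : nat -> G) (s : nat -> X),
    [/\ s 0%N = x, s k = y,
        forall i, (i <= k)%N -> U (s i) &
        forall i, (i < k)%N -> V (g i) /\ s i.+1 = act (g i) (s i)]].

Definition turbulent :=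
  (forall x, dense (Gorbit x) /\ meager (Gorbit x)) /\
  forall x U V, open U -> U x ->
    open V -> V 1 -> (forall g, V g -> V g^-1) ->
    somewhere_dense (local_orbit x U V).

Definition rel_unbalanced x y :=
  forall V U, open V -> V 1 -> open U ->
    U `&` Gorbit x !=set0 \/ U `&` Gorbit y !=set0 ->
    exists gx gy : G,
      [/\ U (act gx x), U (act gy y),
          closure [set act v (act gx x) | v in V] (act gy y) &
          closure [set act v (act gy y) | v in V] (act gx x)].

(* The path visits the [n.+1] points [p 0], ..., [p n]; paths between orbits
   are given by representatives, [rel_unbalanced] being invariant under the
   action in each variable. *)
Definition Gpath C x y :=
  exists (n : nat) (p : nat -> X),
    [/\ p 0%N = x, p n = y,
        forall i, (i <= n)%N -> C (p i) &
        forall i, (i < n)%N -> rel_unbalanced (p i) (p i.+1)].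

Definition generically_semi_connected :=
  forall C, Ginvariant C -> comeager C ->
    exists D : set X, [/\ comeager D, D `<=` C &
      forall x y, D x -> D y -> Gpath C x y].

Definition generically_unbalanced :=
  (forall x, meager (Gorbit x)) /\ generically_semi_connected.

End Actions.

(* Main.v *)
From HB Require Import structures.
From mathcomp Require Import all_boot all_order all_algebra.
From mathcomp Require Import all_classical all_reals all_analysis.
From mathcomp Require Import ring lra zify.
Require Import Defs.

(** The example is a group of lamplighter type. Let c_0 be the additive group
of null sequences, with the sup norm, acting on R^N (product topology) by
translation: this is a turbulent action of an abelian group. Take one copy of
it for every integer and let Z permute the copies: the group
G = Z |>< (c_0)^Z acts on X = (R^N)^Z, a point of X being a real function on
the set of sites N * Z, whose columns are the sets N * {i}.

Complete left-invariant metric on G. The translation part of a group element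
is measured after undoing its shift, that is, in the frame of the element
itself ([seen]); left multiplication does not change this
([ldist_mul2l]), and the discreteness of Z together with the completeness of
(c_0)^Z gives completeness ([lamplighter_complete]).

Turbulence already holds for the translations. The metric of X is a supremum
of truncated coordinate distances, so its balls are boxes, hence convex: a
finitely supported translation that keeps a point in a ball can be divided into
many equal steps, each as small as one likes in c_0 and none leaving the ball
([local_orbit_somewhere_dense]). Orbits are dense because finitely supported
translations prescribe any finite part of a configuration, and meager because
column 0 of g.x differs from column 0 of a shift of x by a bounded sequence
([orbit_meager]).

Unbalancedness uses the shift. A neighborhood V of 1 in G restrains only
finitely many columns: over the other columns it contains a full copy of c_0,
which is dense in R^N. So if x and y agree on a half-space of columns, a long
shift makes them agree on all the restrained columns, and then each of them is
in the closure of the V-translates of the other; a common translation, finitely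
supported, brings both into any prescribed open set ([unbalanced_of_agree]).

Generic semi-connectedness. For arbitrary x, y and l let [mix l x] be l on the
columns of negative index and x on the others. In the sequence
x, mix l x, mix l y, y any two neighbors agree on a half-space. Given a comeager
set C, the Kuratowski-Ulam argument ([mixable_open], [mixable_dense],
[mixable_section]) shows that for generic x the set of l with mix l x in C is
comeager, and the Baire category theorem ([Baire_metric]) provides an l that
works for x and y simultaneously. *)

Set Implicit Arguments.
Unset Strict Implicit.
Unset Printing Implicit Defensive.

Import Order.TTheory GRing.Theory Num.Theory.
Import numFieldNormedType.Exports.

Local Open Scope classical_set_scope.
Local Open Scope ring_scope.

(** * Topology and category in metric spaces *)

Section MetricSpaces.
Context (R : realType).
Implicit Types T U : metricType R.

Lemma nbhs_mdist T (x : T) (A : set T) :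
  nbhs x A <-> exists2 e : R, 0 < e & forall y, mdist x y < e -> A y.
Proof. by rewrite -metricType_numDomainType.filter_from_mdist_nbhs. Qed.

Lemma open_mdist T (A : set T) :
  open A <-> forall x, A x ->
    exists2 e : R, 0 < e & forall y, mdist x y < e -> A y.
Proof.
rewrite openE; split=> h x /h; first by move/nbhs_mdist.
by move=> h'; apply/nbhs_mdist.
Qed.

Lemma mdist_compatible T : compatible_metric (@mdist R T).
Proof.
split; last by move=> A; rewrite open_mdist.
split; [exact: mdist_ge0 | | exact: metric_sym | exact: metric_triangle].
by move=> x y; split=> [/mdist_positivity//|->]; rewrite mdistxx.
Qed.

Lemma closure_mdist T (A : set T) (x : T) :
  closure A x <-> forall e : R, 0 < e -> exists2 y, A y & mdist x y < e.
Proof.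
split=> [clA e e0|h B /nbhs_mdist[e e0 eB]].
  have [|y [Ay /= xy]] := clA [set y | mdist x y < e]; last by exists y.
  by apply/nbhs_mdist; exists e.
by have [y Ay xy] := h e e0; exists y; split=> //; exact: eB.
Qed.

Lemma dense_mdist T (A : set T) :
  dense A <-> forall x (e : R), 0 < e -> exists2 y, A y & mdist x y < e.
Proof.
split=> [dA x e e0|h B [x Bx] /open_mdist/(_ x Bx)[e e0 eB]].
  have [||y [/= xy Ay]] := dA [set y | mdist x y < e]; last by exists y.
    by exists x; rewrite /= mdistxx.
  apply/open_mdist => y /= xy; exists (e - mdist x y); first by rewrite subr_gt0.
  move=> z yz; apply: le_lt_trans (metric_triangle x y z) _.
  by rewrite addrC -ltrBrDr.
by have [y Ay xy] := h x e e0; exists y; split=> //; exact: eB.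
Qed.

Lemma continuous2_mdist T U (Z : metricType R) (f : T * U -> Z) :
  (forall x y (e : R), 0 < e -> exists2 d : R, 0 < d &
    forall x' y', mdist x x' < d -> mdist y y' < d ->
      mdist (f (x, y)) (f (x', y')) < e) ->
  continuous f.
Proof.
move=> h [x y] A /nbhs_mdist[e e0 eA]; have [d d0 dP] := h x y e e0.
exists ([set x' | mdist x x' < d], [set y' | mdist y y' < d]) => /=.
  by split; apply/nbhs_mdist; exists d.
by move=> [x' y'] [/= xx' yy']; apply: eA; exact: dP.
Qed.

Lemma inv_succ_lt (e : R) : 0 < e -> exists n : nat, n.+1%:R^-1 < e.
Proof.
move=> e0; exists (Num.truncn e^-1).
by rewrite -ltf_pV2 ?posrE ?invr_gt0 ?ltr0Sn// invrK truncnS_gt.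
Qed.

(** Nested closed balls: the n-th ball is chosen inside the interior of the
previous one and inside F n, with radius at most 1/(n+1); the centers converge
to a point of all the sets. *)
Theorem Baire_metric T (F : (set T)^nat) (x0 : T) :
  complete_metric (@mdist R T) ->
  (forall n, open (F n) /\ dense (F n)) -> exists x, forall n, F n x.
Proof.
move=> cT odF.
have step (p : nat * (T * R)) : exists q : T * R, 0 < p.2.2 ->
    [/\ 0 < q.2, q.2 <= p.1.+1%:R^-1 &
     forall y, mdist q.1 y <= q.2 -> mdist p.2.1 y < p.2.2 /\ F p.1 y].
  case: p => n [x r] /=; have [r0|] := ltP 0 r; last first.
    by move=> _; exists (x, r).
  have [oF dF] := odF n; have /dense_mdist/(_ x r r0)[y Fy xy] := dF.
  have /open_mdist/(_ y Fy)[e e0 eF] := oF.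
  pose s := Num.min (e / 2) (Num.min ((r - mdist x y) / 2) n.+1%:R^-1).
  exists (y, s) => _; split=> /=.
  - by rewrite !lt_min !divr_gt0 ?subr_gt0//= invr_gt0.
  - by rewrite /s !ge_min lexx !orbT.
  - move=> z yz; have [h1 h2] : mdist y z < e /\ mdist y z < r - mdist x y.
      move: yz; rewrite /s !le_min => /and3P[]; move: xy.
      rewrite -subr_gt0; set u := r - _ => u0; lra.
    split; last exact: eF.
    by apply: le_lt_trans (metric_triangle x y z) _; rewrite -ltrBrDl.
have [f fP] := choice step.
pose fix b n := if n is m.+1 then f (m, b m) else (x0, 1).
have b0 n : 0 < (b n).2.
  by elim: n => [|n IH] //=; have [] := fP (n, b n) IH.
have bS n : [/\ (b n.+1).2 <= n.+1%:R^-1 &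
    forall y, mdist (b n.+1).1 y <= (b n.+1).2 ->
      mdist (b n).1 y < (b n).2 /\ F n y].
  by have [] := fP (n, b n) (b0 n).
clearbody b.
have nest m k y : mdist (b (k + m)%N).1 y <= (b (k + m)%N).2 ->
    mdist (b m).1 y <= (b m).2.
  elim: k => [//|k IH] /= h; apply: IH.
  by have [_ /(_ y h)[/ltW]] := bS (k + m)%N.
have inner m k : (m <= k)%N -> mdist (b m).1 (b k).1 <= (b m).2.
  move=> mk; apply: (@nest m (k - m)%N); rewrite subnK// mdistxx.
  exact: ltW.
have [|l /metricType_numDomainType.cvgrPdist_lt bl] := cT (fun n => (b n).1).
  move=> e e0; have [|N Ne] := @inv_succ_lt (e / 2); first by rewrite divr_gt0.
  exists N.+1 => m n Nm Nn; apply: le_lt_trans (metric_triangle _ (b N.+1).1 _) _.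
  have [rN _] := bS N.
  have := inner _ _ Nm; have := inner _ _ Nn; rewrite (metric_sym (b m).1).
  by move: rN Ne; set c := _^-1; lra.
exists l => n; have [_ h] := bS n; apply: (h l _).2.
apply/ler_addgt0Pr => e e0; have /= := bl e e0.
move=> [N _ /(_ (maxn N n.+1) (leq_maxl _ _)) lb].
apply: le_trans (metric_triangle _ (b (maxn N n.+1)).1 _) _.
by apply: lerD; [exact/inner/leq_maxr|rewrite metric_sym ltW].
Qed.

Lemma meagerU_countable (T : topologicalType) (I : countType)
    (F : I -> set T) (A : set T) :
  (forall i, nowhere_dense (F i)) -> A = \bigcup_i F i -> meager A.
Proof.
move=> ndF ->.
exists (fun n => if unpickle n is Some i then F i else set0) => [n|].
  case: unpickle => //.
  by rewrite /nowhere_dense closure0 interior0.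
apply/seteqP; split=> x.
  by move=> [i _ Fx]; exists (pickle i) => //; rewrite pickleK.
by move=> [n _]; case: unpickle => // i Fx; exists i.
Qed.

Lemma nowhere_denseC T (A : set T) : open A -> dense A -> nowhere_dense (~` A).
Proof.
move=> oA dA; rewrite /nowhere_dense.
have -> : closure (~` A) = ~` A.
  by apply/esym/closure_id; exact: open_closedC.
apply/seteqP; split=> // x; rewrite /interior => /nbhs_mdist[e e0 eA].
have /dense_mdist/(_ x e e0)[y Ay xy] := dA.
by have := eA y xy.
Qed.

Lemma comeager_dense_open T (C : set T) : comeager C ->
  exists U : nat -> set T, (forall n, open (U n) /\ dense (U n)) /\
    forall x, (forall n, U n x) -> C x.
Proof.
move=> [F ndF CF]; exists (fun n => ~` closure (F n)); split=> [n|x Ux].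
  split; first exact/closed_openC/closed_closure.
  apply/dense_mdist => x e e0; apply: contrapT => h.
  suff : (closure (F n))° x by rewrite ndF.
  apply/nbhs_mdist; exists e => // y xy; apply: contrapT => ny.
  by apply: h; exists y.
apply: contrapT => nC.
have : (~` C) x by [].
by rewrite CF => -[n _ Fx]; apply: (Ux n); exact: subset_closure.
Qed.

End MetricSpaces.

(** * The weighted supremum metric on real functions *)

(** For weights tending to 0 this metric defines the product topology; for weights
that are constant on each column of sites, and tend to 0 from column to column,
it defines the product over the columns of the uniform topologies. *)

Section WeightedSup.
Context (R : realType) (J : countType) (w : J -> R).
Hypotheses (w_gt0 : forall j, 0 < w j) (w_le1 : forall j, w j <= 1).
Implicit Types (a b c : J -> R) (e : R).

Definition wdist a b : R := sup (range (fun j => Num.min `|a j - b j| (w j))).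

Let has_ubound_wdist a b :
  has_ubound (range (fun j => Num.min `|a j - b j| (w j))).
Proof. by exists 1 => _ [j _ <-]; rewrite ge_min w_le1 orbT. Qed.

Lemma wdist_ge0 a b : 0 <= wdist a b.
Proof.
rewrite /wdist; set E := range (fun j : J => _).
have [->|/set0P[_ [j _ _]]] := eqVneq E set0; first by rewrite sup0.
have : Num.min `|a j - b j| (w j) <= sup E.
  by apply: ub_le_sup; [exact: has_ubound_wdist|exists j].
by apply: le_trans; rewrite le_min normr_ge0 ltW.
Qed.

(** Closed balls are boxes: each coordinate is either confined to an interval
or, when its weight is at most e, free. *)
Lemma wdist_leP a b e : 0 <= e ->
  wdist a b <= e <-> forall j, `|a j - b j| <= e \/ w j <= e.
Proof.
move=> e0; rewrite /wdist; set E := range (fun j : J => _).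
split=> [le_e j|h].
  have : Num.min `|a j - b j| (w j) <= e.
    apply: le_trans le_e; apply: ub_le_sup; first exact: has_ubound_wdist.
    by exists j.
  by rewrite ge_min => /orP.
have [->|E0] := eqVneq E set0; first by rewrite sup0.
apply: ge_sup; first exact/set0P.
by move=> _ [j _ <-]; rewrite ge_min; apply/orP; exact: h.
Qed.

Lemma wdist_coord a b e j : wdist a b <= e -> e < w j -> `|a j - b j| <= e.
Proof.
move=> abe ew; have /wdist_leP h := le_trans (wdist_ge0 a b) abe.
by have [//|] := (h a b).1 abe j; rewrite leNgt ew.
Qed.

Lemma wdist_le1 a b : wdist a b <= 1.
Proof. by apply/wdist_leP => // j; right. Qed.

Lemma wdistxx a : wdist a a = 0.
Proof.
apply/eqP; rewrite eq_le wdist_ge0 andbT; apply/wdist_leP => // j.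
by left; rewrite subrr normr0.
Qed.

Lemma wdist_eq0 a b : wdist a b = 0 -> a = b.
Proof.
move=> ab0; apply/funext => j; apply/eqP; rewrite -subr_eq0 -normr_le0.
by apply: (@wdist_coord a b 0 j) (w_gt0 j); rewrite ab0.
Qed.

Lemma eq_wdist a b c d : (forall j, `|a j - b j| = `|c j - d j|) ->
  wdist a b = wdist c d.
Proof.
move=> h; rewrite /wdist.
by have -> : (fun j => Num.min `|a j - b j| (w j)) =
  (fun j => Num.min `|c j - d j| (w j)) by apply/funext => j; rewrite h.
Qed.

Lemma wdistC a b : wdist a b = wdist b a.
Proof. by apply: eq_wdist => j; exact: distrC. Qed.

Lemma wdist_triangle b a c : wdist a c <= wdist a b + wdist b c.
Proof.
have ab0 := wdist_ge0 a b; have bc0 := wdist_ge0 b c.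
apply/wdist_leP => [|j]; first exact: addr_ge0.
have [wj|wj] := leP (w j) (wdist a b + wdist b c); [by right|left].
rewrite -(subrKA (b j)); apply: le_trans (ler_normD _ _) _.
by apply: lerD; apply: wdist_coord => //; lra.
Qed.

Lemma wdistD c a b : wdist (fun j => c j + a j) (fun j => c j + b j) = wdist a b.
Proof. by apply: eq_wdist => j; rewrite opprD addrACA subrr add0r. Qed.

(** Reindexing is Lipschitz when it changes the weights by a bounded factor;
this makes the shifts act continuously. *)
Lemma wdist_comp (s : J -> J) (K : R) a b : 1 <= K ->
  (forall j, w j <= K * w (s j)) ->
  wdist (a \o s) (b \o s) <= K * wdist a b.
Proof.
move=> K1 wK; have ab0 := wdist_ge0 a b; have K0 : 0 < K by lra.
apply/wdist_leP => [|j /=]; first by rewrite mulr_ge0// ltW.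
have [wj|wj] := leP (w (s j)) (wdist a b).
  by right; apply: le_trans (wK j) _; rewrite ler_pM2l.
left; apply: le_trans (wdist_coord (lexx _) wj) _.
by rewrite ler_peMl.
Qed.

Theorem wdist_complete (u : nat -> J -> R) :
  (forall e, 0 < e -> exists N : nat, forall m n : nat,
    (N <= m)%N -> (N <= n)%N -> wdist (u m) (u n) < e) ->
  exists l : J -> R, forall e, 0 < e ->
    exists N : nat, forall n : nat, (N <= n)%N -> wdist l (u n) <= e.
Proof.
move=> cu.
have cvgu j : cvg ((u n j) @[n --> \oo]).
  apply: cauchy_cvg; apply: cauchy_exP => e e0.
  have [|N hN] := cu (Num.min (e / 2) (w j / 2)).
    by rewrite lt_min !divr_gt0.
  exists (u N j); exists N => // n /= Nn.
  rewrite /ball /=; have := hN N n (leqnn N) Nn; rewrite lt_min => /andP[h1 h2].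
  apply: (@le_lt_trans _ _ (wdist (u N) (u n))); last lra.
  by apply: wdist_coord => //; have := w_gt0 j; lra.
exists (fun j => lim ((u n j) @[n --> \oo])) => e e0.
have [N hN] := cu e e0; exists N => n Nn; apply/wdist_leP => [|j]; first exact: ltW.
have [wj|wj] := leP (w j) e; [by right|left].
apply/ler_addgt0Pr => d d0.
have /cvgrPdist_lt/(_ d d0)[M _ hM] := cvgu j.
pose k := maxn N M.
have h1 : `|lim (u n j @[n --> \oo]) - u k j| < d by exact/hM/leq_maxr.
have h2 : `|u k j - u n j| <= e.
  by apply: wdist_coord wj; apply: ltW; apply: hN => //; exact: leq_maxl.
rewrite -(subrKA (u k j)); apply: le_trans (ler_normD _ _) _; lra.
Qed.

(** The closure of the finitely supported functions ([finite_rational_dense],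
[vanishing_closed]): all functions when the weights tend to 0, and the
functions whose columns are null sequences in the second case above. *)
Definition vanishing a :=
  forall e, 0 < e -> finite_set [set j | e < `|a j| /\ e < w j].

Lemma vanishing_finite (s : seq J) a :
  (forall j, j \notin s -> a j = 0) -> vanishing a.
Proof.
move=> h e e0; apply: (@sub_finite_set _ _ [set` s]); last exact: finite_seq.
move=> j /= [+ _]; apply: contraTT => /h ->.
by rewrite normr0 -leNgt ltW.
Qed.

Lemma vanishing_weight a :
  (forall e, 0 < e -> finite_set [set j | e < w j]) -> vanishing a.
Proof.
by move=> h e e0; apply: sub_finite_set (h e e0) => j /= [].
Qed.

Lemma vanishing0 : vanishing (fun=> 0).
Proof. by apply: (@vanishing_finite [::]). Qed.

Lemma vanishingD a b : vanishing a -> vanishing b ->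
  vanishing (fun j => a j + b j).
Proof.
move=> va vb e e0; have e20 : 0 < e / 2 by lra.
have : finite_set ([set j | e / 2 < `|a j| /\ e / 2 < w j] `|`
                   [set j | e / 2 < `|b j| /\ e / 2 < w j]).
  by rewrite finite_setU; split; [exact: va|exact: vb].
apply: sub_finite_set => j /= [h1 h2]; have := ler_normD (a j) (b j) => h3.
have [|?] := leP (`|a j|) (e / 2); last by left; lra.
by right; lra.
Qed.

Lemma vanishingN a : vanishing a -> vanishing (fun j => - a j).
Proof.
move=> va e e0; apply: sub_finite_set (va e e0) => j /=.
by rewrite normrN.
Qed.

Lemma vanishing_comp (s : J -> J) (K : R) a : 1 <= K -> injective s ->
  (forall j, w j <= K * w (s j)) -> vanishing a -> vanishing (a \o s).
Proof.
move=> K1 injs wK va e e0; have K0 : 0 < K by lra.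
have eK0 : 0 < e / K by rewrite divr_gt0.
apply: (@sub_finite_set _ _ (s @^-1` [set j | e / K < `|a j| /\ e / K < w j])).
  move=> j /= [h1 h2]; split.
    apply: le_lt_trans h1; rewrite ler_pdivrMr// ler_peMr// ltW//.
  by rewrite ltr_pdivrMr// mulrC; apply: lt_le_trans h2 _.
by apply: finite_preimage (va _ eK0) => x y _ _; exact: injs.
Qed.

Lemma vanishing_closed a :
  (forall e, 0 < e -> exists2 b, vanishing b & wdist a b <= e) -> vanishing a.
Proof.
move=> h e e0; have e20 : 0 < e / 2 by lra.
have [b vb ab] := h _ e20; apply: sub_finite_set (vb _ e20) => j /= [h1 h2].
have ew : e / 2 < w j by lra.
have h3 := wdist_coord ab ew; split => //.
have := ler_normD (a j - b j) (b j); rewrite subrK; lra.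
Qed.

(** A countable family: each finite list of sites paired with rationals is read
as an association list with default value 0. *)
Definition finite_rational (s : seq (J * rat)) : J -> R :=
  fun j => ratr (nth 0%Q (map snd s) (index j (map fst s))).

Lemma finite_rational_vanishing s : vanishing (finite_rational s).
Proof.
apply: (@vanishing_finite (map fst s)) => j js; rewrite /finite_rational.
by rewrite nth_default ?raddf0// (memNindex js) !size_map.
Qed.

Lemma finite_rational_dense a e : vanishing a -> 0 < e ->
  exists s, wdist a (finite_rational s) <= e.
Proof.
move=> va e0; have /finite_seqP[s sP] := va e e0.
have q_ex j : exists q : rat, `|a j - ratr q| <= e.
  have [|q] := @rat_in_itvoo R (a j - e) (a j + e); first lra.
  rewrite in_itv /= => /andP[h1 h2]; exists q; rewrite ler_distl; lra.
have [q qP] := choice q_ex.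
exists [seq (j, q j) | j <- s]; apply/wdist_leP => [|j]; first exact: ltW.
rewrite /finite_rational -!map_comp /=.
have -> : map (fst \o (fun j => (j, q j))) s = s by rewrite -[RHS]map_id.
have [js|js] := boolP (j \in s).
  by left; rewrite (nth_map j) ?index_mem// nth_index//=.
have : ~ [set` s] j by exact/negP.
rewrite -sP /= nth_default; last by rewrite (memNindex js) size_map.
rewrite raddf0 subr0.
have [|h1] := leP `|a j| e; first by left.
by have [|h2 []] := leP (w j) e; first by right.
Qed.

(** All but finitely many coordinates are small already or weigh little, and the
remaining ones have a common bound. *)
Lemma vanishing_scale a e : vanishing a -> 0 < e ->
  exists N : nat, wdist (fun j => a j / N.+1%:R) (fun=> 0) <= e.
Proof.
move=> va e0; have /finite_seqP[s sP] := va e e0.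
pose M := \sum_(j <- s) `|a j|; exists (Num.truncn (M / e)).
set N := Num.truncn _; have MN : M / e < N.+1%:R by exact: truncnS_gt.
apply/wdist_leP => [|j]; first exact: ltW.
have [wj|wj] := leP (w j) e; [by right|left].
rewrite subr0 normrM normfV (ger0_norm (ler0n _ _)) ler_pdivrMr ?ltr0Sn//.
have [js|js] := boolP (j \in s).
  apply: (@le_trans _ _ M).
    rewrite /M (perm_big _ (perm_to_rem js)) big_cons lerDl.
    by apply: sumr_ge0 => i _.
  by rewrite mulrC -ler_pdivrMr// ltW.
have : ~ [set` s] j by exact/negP.
rewrite -sP /= => h; have : `|a j| <= e.
  by rewrite leNgt; apply/negP => h1; apply: h.
by move=> /le_trans; apply; rewrite ler_peMr ?ler1n// ltW.
Qed.

End WeightedSup.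

Lemma le_wdist (R : realType) (J : countType) (w w' : J -> R) (a b : J -> R) :
  (forall j, 0 < w j) -> (forall j, w j <= w' j) -> (forall j, w' j <= 1) ->
  wdist w a b <= wdist w' a b.
Proof.
move=> w0 ww' w'1; have w1 j : w j <= 1 by exact: le_trans (ww' j) (w'1 j).
have w'0 j : 0 < w' j by exact: lt_le_trans (w0 j) (ww' j).
have d0 : 0 <= wdist w' a b by exact: wdist_ge0.
apply/wdist_leP => // j.
have [|] := (wdist_leP w'1 a b d0).1 (lexx _) j; first by left.
by right; exact: le_trans (ww' j) _.
Qed.

(** * Sites, shifts and the two weights *)

Notation site := (nat * int)%type.

Definition shift (s : int) (j : site) : site := (j.1, j.2 - s).

Lemma shiftD s t j : shift s (shift t j) = shift (s + t) j.
Proof. by rewrite /shift /= opprD addrA addrAC. Qed.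

Lemma shift0 j : shift 0 j = j.
Proof. by case: j => n i; rewrite /shift subr0. Qed.

Lemma shiftK s j : shift s (shift (- s) j) = j.
Proof. by rewrite shiftD subrr shift0. Qed.

Lemma shiftNK s j : shift (- s) (shift s j) = j.
Proof. by rewrite shiftD addNr shift0. Qed.

Lemma shift_inj s : injective (shift s).
Proof. exact: can_inj (shiftNK s). Qed.

Section Weights.
Context (R : realType).

(** [coarse] is constant on columns, so [wdist coarse] is uniform on each
column; [fine] tends to 0, so [wdist fine] gives the product topology. Both
decay so slowly that a shift changes them by at most the factor
[shift_cst]. *)
Definition coarse (j : site) : R := (1 + absz j.2)%N%:R^-1.
Definition fine (j : site) : R := (1 + j.1 + absz j.2)%N%:R^-1.
Definition shift_cst (s : int) : R := (1 + absz s)%N%:R.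

Lemma coarse_gt0 j : 0 < coarse j. Proof. by rewrite invr_gt0 ltr0n. Qed.
Lemma fine_gt0 j : 0 < fine j. Proof. by rewrite invr_gt0 ltr0n. Qed.

Lemma coarse_le1 j : coarse j <= 1.
Proof. by rewrite invf_le1 ?ltr0n// ler1n. Qed.

Lemma fine_coarse j : fine j <= coarse j.
Proof. by rewrite lef_pV2 ?posrE ?ltr0n// ler_nat; lia. Qed.

Lemma fine_le1 j : fine j <= 1.
Proof. exact: le_trans (fine_coarse j) (coarse_le1 j). Qed.

Lemma shift_cst_ge1 s : 1 <= shift_cst s.
Proof. by rewrite ler1n. Qed.

Lemma coarse_shift s j : coarse j <= shift_cst s * coarse (shift s j).
Proof.
rewrite /coarse /shift_cst ler_pdivlMr ?ltr0n// mulrC ler_pdivrMr ?ltr0n//.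
rewrite -natrM ler_nat /=; have : (absz (j.2 - s) <= absz j.2 + absz s)%N by lia.
nia.
Qed.

Lemma fine_shift s j : fine j <= shift_cst s * fine (shift s j).
Proof.
rewrite /fine /shift_cst ler_pdivlMr ?ltr0n// mulrC ler_pdivrMr ?ltr0n//.
rewrite -natrM ler_nat /=; have : (absz (j.2 - s) <= absz j.2 + absz s)%N by lia.
nia.
Qed.

Lemma finite_fine e : 0 < e -> finite_set [set j | e < fine j].
Proof.
move=> e0; pose N := (Num.truncn e^-1).+1.
have fN : finite_set (`I_N `*` ((fun k => Posz k - Posz N) @` `I_(N + N))).
  by apply: finite_setX; [exact: finite_II|apply: finite_image; exact: finite_II].
apply: sub_finite_set fN => -[n i] /=; rewrite /fine /=.
have eN : e^-1 < N%:R by exact: truncnS_gt.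
rewrite -ltf_pV2 ?posrE ?invr_gt0 ?ltr0n// invrK => h.
have := lt_trans h eN; rewrite ltr_nat => niN; split=> /=; first lia.
by exists (absz (i + Posz N)); lia.
Qed.

Lemma vanishing_fine (x : site -> R) : vanishing fine x.
Proof. by apply: vanishing_weight; exact: finite_fine. Qed.

End Weights.
Arguments shift_cst {R} s.

(** * The group *)

(** The pair (s, a) stands for the transformation that shifts by s and then
translates by a. *)
Record lamplighter (R : realType) := Lamplighter {
  displacement : int;
  lamps : site -> R;
  lamps_vanishing : vanishing (@coarse R) lamps }.

HB.instance Definition _ (R : realType) := gen_eqMixin (lamplighter R).
HB.instance Definition _ (R : realType) := gen_choiceMixin (lamplighter R).

Section LamplighterGroup.
Context (R : realType).
Notation G := (lamplighter R).
Implicit Types g h k : G.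
Local Notation cdist := (wdist (@coarse R)).

Lemma lamplighter_eq g h : displacement g = displacement h ->
  (forall j, lamps g j = lamps h j) -> g = h.
Proof.
case: g h => s a va [t b vb] /= <- /funext ab; subst b.
by congr Lamplighter; exact: Prop_irrelevance.
Qed.

Lemma vanishing_shift s a :
  vanishing (@coarse R) a -> vanishing (@coarse R) (a \o shift s).
Proof.
apply: vanishing_comp (shift_cst_ge1 R s) _ _; first exact: shift_inj.
exact: coarse_shift.
Qed.

Definition lamplighter1 : G :=
  Lamplighter 0 (vanishing0 (@coarse R)).

Definition lamplighterM g h : G :=
  Lamplighter (displacement g + displacement h)
    (vanishingD (lamps_vanishing g)
       (vanishing_shift (displacement g) (lamps_vanishing h))).

Definition lamplighterV g : G :=
  Lamplighter (- displacement g)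
    (vanishingN (vanishing_shift (- displacement g) (lamps_vanishing g))).

Lemma lamplighterA : associative lamplighterM.
Proof.
move=> g h k; apply: lamplighter_eq => /= [|j]; first exact: addrA.
by rewrite shiftD addrA [displacement h + _]addrC.
Qed.

Lemma lamplighter1M : left_id lamplighter1 lamplighterM.
Proof.
move=> g; apply: lamplighter_eq => /= [|j]; first exact: add0r.
by rewrite add0r shift0.
Qed.

Lemma lamplighterM1 : right_id lamplighter1 lamplighterM.
Proof. by move=> g; apply: lamplighter_eq => /= [|j]; rewrite addr0. Qed.

Lemma lamplighterVM : left_inverse lamplighter1 lamplighterV lamplighterM.
Proof. by move=> g; apply: lamplighter_eq => /= [|j]; rewrite addNr. Qed.

Lemma lamplighterMV : right_inverse lamplighter1 lamplighterV lamplighterM.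
Proof.
move=> g; apply: lamplighter_eq => /= [|j]; first by rewrite subrr.
by rewrite shiftNK subrr.
Qed.

HB.instance Definition _ := isGroup.Build G lamplighterA lamplighter1M
  lamplighterM1 lamplighterVM lamplighterMV.

(** The lamps in the frame of the displaced lamplighter. Left multiplication by
h adds the same function to the [seen] lamps of all elements with a given
displacement, which is why [ldist] is left-invariant. *)
Definition seen g : site -> R := lamps g \o shift (- displacement g).

(** The value 1 between different displacements bounds [wdist] from above, as
the triangle inequality requires. *)
Definition ldist g h : R :=
  if displacement g == displacement h then cdist (seen g) (seen h) else 1.

Let c0 := @coarse_gt0 R.
Let c1 := @coarse_le1 R.

Lemma ldist_le1 g h : ldist g h <= 1.
Proof. by rewrite /ldist; case: ifP => // _; exact: (wdist_le1 c1). Qed.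

Lemma ldist_ge0 g h : 0 <= ldist g h.
Proof. by rewrite /ldist; case: ifP => // _; exact: (wdist_ge0 c0 c1). Qed.

Lemma ldist_lt1 g h : ldist g h < 1 -> displacement g = displacement h.
Proof. by rewrite /ldist; case: eqP => //; rewrite ltxx. Qed.

Lemma ldistxx g : ldist g g = 0.
Proof. by rewrite /ldist eqxx (wdistxx c0 c1). Qed.

Lemma ldist_eq0 g h : ldist g h = 0 -> g = h.
Proof.
rewrite /ldist; case: eqP => [gh|_ /eqP]; last by rewrite oner_eq0.
move/(wdist_eq0 c0 c1) => sgh; apply: lamplighter_eq => // j.
have := congr1 (fun f => f (shift (displacement g) j)) sgh.
by rewrite /seen /= -gh shiftNK.
Qed.

Lemma ldistC g h : ldist g h = ldist h g.
Proof. by rewrite /ldist eq_sym wdistC. Qed.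

Lemma ldist_triangle h g k : ldist g k <= ldist g h + ldist h k.
Proof.
have [gh|gh] := eqVneq (displacement g) (displacement h); last first.
  rewrite {2}/ldist (negbTE gh); apply: le_trans (ldist_le1 g k) _.
  by rewrite lerDl ldist_ge0.
have [hk|hk] := eqVneq (displacement h) (displacement k); last first.
  rewrite {3}/ldist (negbTE hk); apply: le_trans (ldist_le1 g k) _.
  by rewrite lerDr ldist_ge0.
by rewrite /ldist gh hk eqxx; exact: (wdist_triangle c0 c1).
Qed.

HB.instance Definition _ :=
  isMetric.Build R G ldistxx ldist_eq0 ldistC ldist_triangle.

Lemma mdist_lamplighterE g h : mdist g h = ldist g h.
Proof. by []. Qed.


Lemma ldist_mul2l (g h k : G) : ldist (g * h)%g (g * k)%g = ldist h k.
Proof.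
rewrite /ldist /= (inj_eq (addrI _)); case: eqP => // hk.
apply: eq_wdist => j; rewrite /seen /= hk !shiftD.
have -> : (displacement g + - (displacement g + displacement k))%R =
  (- displacement k)%R by rewrite opprD addrA subrr add0r.
by congr (`|_|)%R; lra.
Qed.

(** Right multiplication by k moves the frame by the displacement of k, which
only changes the weights by a bounded factor; with left-invariance this makes
both group operations continuous. *)
Lemma ldist_mul2r (g h k : G) :
  (ldist (g * k)%g (h * k)%g <= shift_cst (displacement k) * ldist g h)%R.
Proof.
rewrite /ldist /= (inj_eq (addIr _)); case: eqP => [gh|_]; last first.
  by rewrite mulr1 shift_cst_ge1.
have <- : shift_cst (- displacement k) = shift_cst (displacement k) :> R.
  by rewrite /shift_cst abszN.
apply: le_trans (wdist_comp c0 c1 _ _ (shift_cst_ge1 R _)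
  (@coarse_shift R (- displacement k))).
rewrite le_eqVlt; apply/orP; left; apply/eqP; apply: eq_wdist => j.
have E : shift (- (displacement h + displacement k)) j =
  shift (- displacement h) (shift (- displacement k) j) by rewrite shiftD opprD.
by rewrite /seen /= gh E; congr `|_|; lra.
Qed.

Lemma mulg_lamplighter_continuous : continuous (fun p : G * G => p.1 * p.2)%g.
Proof.
apply: continuous2_mdist => g h e e0 /=.
pose K : R := shift_cst (displacement h).
have K1 : 1 <= K by exact: shift_cst_ge1.
exists (Num.min 1 (e / (2 * K))); first by rewrite lt_min ltr01 divr_gt0//; lra.
move=> g' h'; rewrite !mdist_lamplighterE !lt_min => /andP[_ gg'] /andP[hh1 hh'].
apply: le_lt_trans (ldist_triangle (g' * h)%g _ _) _.
rewrite ldist_mul2l.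
have := ldist_mul2r g g' h; rewrite -/K.
move: gg' hh'; rewrite !ltr_pdivlMr; [|lra|lra].
have := ldist_ge0 h h'; nra.
Qed.

Lemma invg_lamplighter_continuous : continuous (fun g : G => g^-1)%g.
Proof.
move=> g A /nbhs_mdist[e e0 eA]; apply/nbhs_mdist.
pose K : R := shift_cst (displacement g^-1%g).
have K1 : 1 <= K by exact: shift_cst_ge1.
exists (e / K); first by rewrite divr_gt0//; lra.
move=> h; rewrite mdist_lamplighterE ltr_pdivlMr; last lra.
move=> gh; apply: eA; rewrite mdist_lamplighterE.
rewrite -(ldist_mul2l h) mulgV -(mulgV g) ldistC.
by apply: le_lt_trans (ldist_mul2r _ _ _) _; rewrite mulrC.
Qed.

HB.instance Definition _ := PreTopologicalGroup_isTopologicalGroup.Build G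
  mulg_lamplighter_continuous invg_lamplighter_continuous.

(** Along a Cauchy sequence the displacement is eventually constant, and from
then on the [seen] lamps form a Cauchy sequence of vanishing functions. *)
Lemma lamplighter_complete : complete_metric (@mdist R G).
Proof.
move=> u cu.
have [N1 hN1] := cu 1 ltr01.
pose s := displacement (u N1).
have us n : (N1 <= n)%N -> displacement (u n) = s.
  by move=> N1n; apply/esym/ldist_lt1; exact: hN1.
have [e e0|l hl] := @wdist_complete R _ _ c0 c1 (fun n => seen (u (N1 + n)%N)).
  have [N hN] := cu e e0; exists N => m n Nm Nn.
  have := hN (N1 + m)%N (N1 + n)%N (leq_trans Nm (leq_addl _ _))
    (leq_trans Nn (leq_addl _ _)).
  by rewrite mdist_lamplighterE /ldist !us ?leq_addr// eqxx.
have vl : vanishing (@coarse R) l.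
  apply: (vanishing_closed c0 c1) => e e0; have [N hN] := hl e e0.
  exists (seen (u (N1 + N)%N)); last exact: hN.
  by apply: vanishing_shift; exact: lamps_vanishing.
exists (Lamplighter s (vanishing_shift s vl)).
apply/metricType_numDomainType.cvgrPdist_le => e e0; have [N hN] := hl e e0.
exists (N1 + N)%N => // n /= Nn; rewrite mdist_lamplighterE /ldist /=.
rewrite us; last by lia.
rewrite eqxx; have := hN (n - N1)%N; rewrite subnKC; last lia.
have -> : seen (Lamplighter s (vanishing_shift s vl)) = l.
  by apply/funext => j; rewrite /seen /= shiftK.
by apply; lia.
Qed.

Lemma lamplighter_separable : separable_space G.
Proof.
pose f (p : int * seq (site * rat)) : G :=
  Lamplighter p.1 (@finite_rational_vanishing R _ (@coarse R) p.2).
exists (range f); first exact: sub_countable (card_image_le _ _) (countableP _).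
apply/dense_mdist => g e e0; pose s := displacement g.
have K1 := @shift_cst_ge1 R (- s).
have [|q gq] := @finite_rational_dense R _ _ c1 _ (e / (2 * shift_cst (- s)))
  (lamps_vanishing g); first by rewrite divr_gt0//; lra.
exists (f (s, q)); first by exists (s, q).
rewrite mdist_lamplighterE /ldist eqxx /seen /=.
apply: le_lt_trans (wdist_comp c0 c1 _ _ K1 (@coarse_shift R _)) _.
move: gq; rewrite ler_pdivlMr; last lra.
nra.
Qed.

Lemma lamplighter_CLI : CLI R G.
Proof.
exists (@mdist R G); split; [exact: mdist_compatible|exact: lamplighter_complete|].
exact: ldist_mul2l.
Qed.

Lemma lamplighter_polish : polish_group R G.
Proof.
split; first exact: lamplighter_separable.
exists (@mdist R G); split; [exact: mdist_compatible|exact: lamplighter_complete].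
Qed.

End LamplighterGroup.

(** * The space of configurations and the action *)

(** An alias, so that the metric attached to it does not compete with other
structures on function types. *)
Definition configuration (R : realType) : Type := site -> R.

HB.instance Definition _ (R : realType) :=
  Choice.copy (configuration R) (site -> R).

HB.instance Definition _ (R : realType) :=
  isMetric.Build R (configuration R)
    (wdistxx (@fine_gt0 R) (@fine_le1 R))
    (fun x y => @wdist_eq0 R _ _ (@fine_gt0 R) (@fine_le1 R) x y)
    (@wdistC R _ (@fine R))
    (wdist_triangle (@fine_gt0 R) (@fine_le1 R)).

Section Configurations.
Context (R : realType).
Local Notation X := (configuration R).
Local Notation G := (lamplighter R).
Implicit Types (x y z l : X) (g : G).
Let f0 := @fine_gt0 R.
Let f1 := @fine_le1 R.
Let c0 := @coarse_gt0 R.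
Let c1 := @coarse_le1 R.

Lemma mdist_configuration_leP x y (e : R) : 0 <= e ->
  mdist x y <= e <-> forall j, `|x j - y j| <= e \/ fine R j <= e.
Proof. exact: wdist_leP. Qed.

Lemma mdist_configuration_coord x y (e : R) j :
  mdist x y <= e -> e < fine R j -> `|x j - y j| <= e.
Proof. exact: wdist_coord. Qed.

Lemma configuration_complete : complete_metric (@mdist R X).
Proof.
move=> u /(wdist_complete f0 f1)[l hl]; exists (l : X).
apply/metricType_numDomainType.cvgrPdist_le => e e0; have [N hN] := hl e e0.
by exists N => // n /= Nn; exact: hN.
Qed.

Lemma finite_rational_dense_fine x (e : R) : 0 < e ->
  exists s, mdist x (finite_rational R s : X) <= e.
Proof. exact: finite_rational_dense f1 _ _ (vanishing_fine x). Qed.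

Lemma configuration_polish : polish_space R X.
Proof.
split; last first.
  exists (@mdist R X); split; first exact: mdist_compatible.
  exact: configuration_complete.
exists (range (fun s => finite_rational R s : X)).
  exact: sub_countable (card_image_le _ _) (countableP _).
apply/dense_mdist => x e e0.
have [|s xs] := @finite_rational_dense_fine x (e / 2); first lra.
exists (finite_rational R s); first by exists s.
by apply: le_lt_trans xs _; lra.
Qed.

Definition lamp_act g x : X := fun j => lamps g j + x (shift (displacement g) j).

Lemma lamp_act_left : left_action lamp_act.
Proof.
split=> [x|g h x]; apply/funext => j; rewrite /lamp_act /=.
  by rewrite add0r shift0.
by rewrite shiftD -addrA [displacement h + _]addrC.
Qed.

Lemma mdist_lamp_act g x y :
  mdist (lamp_act g x) (lamp_act g y) <= shift_cst (displacement g) * mdist x y.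
Proof.
have K1 := @shift_cst_ge1 R (displacement g).
apply: le_trans (wdist_comp f0 f1 x y K1 (@fine_shift R _)).
by rewrite le_eqVlt; apply/orP; left; apply/eqP; exact: wdistD.
Qed.

Lemma mdist_lamp_actl g h x : displacement g = displacement h ->
  mdist (lamp_act g x) (lamp_act h x) <=
    shift_cst (displacement g) * mdist g h.
Proof.
move=> gh; have K1 := @shift_cst_ge1 R (displacement g).
rewrite mdist_lamplighterE /ldist gh eqxx.
apply: le_trans (wdist_comp c0 c1 _ _ (shift_cst_ge1 R _) (@coarse_shift R _)).
apply: le_trans (le_wdist _ _ f0 (@fine_coarse R) c1).
rewrite le_eqVlt; apply/orP; left; apply/eqP; apply: eq_wdist => j.
by rewrite /seen /lamp_act /= gh !shiftNK; congr `|_|; lra.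
Qed.

Lemma lamp_act_continuous : continuous (fun p : G * X => lamp_act p.1 p.2).
Proof.
apply: continuous2_mdist => g x e e0 /=.
pose K : R := shift_cst (displacement g).
have K1 : 1 <= K by exact: shift_cst_ge1.
exists (Num.min 1 (e / (2 * K))); first by rewrite lt_min ltr01 divr_gt0//; lra.
move=> h y; rewrite !lt_min => /andP[/ldist_lt1 gh gh'] /andP[_ xy].
apply: le_lt_trans (metric_triangle _ (lamp_act g y) _) _.
have := mdist_lamp_act g x y; have := mdist_lamp_actl y gh; rewrite -/K.
by move: gh' xy; rewrite !ltr_pdivlMr; [|lra|lra]; nra.
Qed.

Lemma lamp_act_polish : polish_Gspace lamp_act R.
Proof.
split; [exact: lamplighter_polish|exact: configuration_polish|
  exact: lamp_act_left|exact: lamp_act_continuous].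
Qed.

(** * Turbulence *)

Lemma fine_window (e : R) : 0 < e ->
  exists s : seq site, forall j, j \notin s -> fine R j <= e.
Proof.
move=> e0; have /finite_seqP[s sP] := finite_fine e0.
exists s => j js; rewrite leNgt; apply/negP => ej.
by have : [set j | e < fine R j] j by []; rewrite sP /= (negbTE js).
Qed.

(** Elements of the group whose effect on x is to replace it by y on a finite
set of sites; they serve for all density arguments below. *)
Lemma patch_subproof (s : seq site) x y :
  vanishing (@coarse R) (fun j => if j \in s then y j - x j else 0).
Proof. by apply: (@vanishing_finite _ _ _ s) => j /negbTE ->. Qed.

Definition patch (s : seq site) x y : G := Lamplighter 0 (patch_subproof s x y).

Lemma patchE s x y j :
  lamp_act (patch s x y) x j = if j \in s then y j else x j.
Proof.
by rewrite /lamp_act /= shift0; case: ifP => _; rewrite ?subrK ?add0r.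
Qed.

Lemma patch_near s x y (e : R) : 0 < e ->
  (forall j, j \notin s -> fine R j <= e) ->
  mdist y (lamp_act (patch s x y) x) <= e.
Proof.
move=> e0 se; apply/mdist_configuration_leP => [|j]; first exact: ltW.
rewrite patchE; case: ifPn => [_|/se]; last by right.
by left; rewrite subrr normr0 ltW.
Qed.

Lemma orbit_dense x : dense (Gorbit lamp_act x).
Proof.
apply/dense_mdist => y e e0.
have [|s sP] := @fine_window (e / 2); first lra.
exists (lamp_act (patch s x y) x); first by exists (patch s x y).
by apply: le_lt_trans (patch_near _ _ _ sP) _; lra.
Qed.

Lemma seq_bound (I : eqType) (s : seq I) (h : I -> nat) :
  exists m, forall i, i \in s -> (h i <= m)%N.
Proof. by exists (\max_(i <- s) h i) => i si; exact: leq_bigmax_seq. Qed.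

(** The lamps of g are at most 1/2 in column 0, from some row on. So the orbit
is a countable union, over the displacement s and the row m, of sets whose
closures exclude any q with q (n, 0) = x (shift s (n, 0)) + 3 for some n > m;
such q exist in every ball, since coordinates far up the column weigh little. *)
Lemma orbit_meager x : meager (Gorbit lamp_act x).
Proof.
pose F (p : int * nat) : set X := [set y | exists g,
  [/\ y = lamp_act g x, displacement g = p.1 &
      forall n, (p.2 < n)%N -> `|lamps g (n, 0)| <= 1 / 2]].
apply: (@meagerU_countable X _ F) => [[s m]|]; last first.
  apply/seteqP; split=> [_ [g _ <-]|y [p _ [g [-> _ _]]]]; last by exists g.
  have h0 : 0 < (1 / 2 : R) by lra.
  have /finite_seqP[s sP] := lamps_vanishing g h0.
  have [m sm] := seq_bound s fst.
  exists (displacement g, m) => //; exists g; split=> // n mn.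
  rewrite leNgt; apply/negP => hn.
  have : [set` s] (n, 0).
    by rewrite -sP; split=> //; rewrite /coarse /= addn0 invr1; lra.
  by move=> /= /sm /=; rewrite leqNgt mn.
apply/seteqP; split=> // p /nbhs_mdist[e e0 eF].
have [N Ne] := inv_succ_lt e0; pose n := (maxn N m).+1.
have fn : fine R (n, 0) < e.
  apply: le_lt_trans Ne; rewrite /fine /= addn0 lef_pV2 ?posrE ?ltr0n// ler_nat.
  by rewrite /n; lia.
(* A point of the ball around p that differs by more than 2 from every point of
   F at (n, 0), a coordinate whose weight is below e. *)
pose q : X := fun j => if j == (n, 0) then x (shift s j) + 3 else p j.
have pq : mdist p q < e.
  apply: le_lt_trans fn; apply/mdist_configuration_leP => [|j].
    by rewrite ltW// f0.
  rewrite /q; case: eqP => [->|_]; first by right.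
  by left; rewrite subrr normr0 ltW// f0.
have [_ [g [-> gs gm]] qz] := (closure_mdist _ _).1 (eF q pq) _ (f0 (n, 0)).
have := mdist_configuration_coord (lexx _) qz.
have := gm n; rewrite /= /n ltnS leq_maxr => /(_ isT); rewrite -/n.
move: qz (f1 (n, 0)); rewrite /q /lamp_act gs eqxx.
set d := mdist _ _; set a := lamps g _; set b := x _.
by move=> h1 h2; rewrite !ler_norml; lra.
Qed.

(** Every ball around x inside U lies in the closure of the local orbit: a
point y of the ball is approximated by patching x with finitely many values of
y, and the straight path from x to the patched point stays in the ball because
balls are boxes. Its N+1 steps are the same small group element. *)
Lemma local_orbit_somewhere_dense x (U : set X) (V : set G) :
  open U -> U x -> open V -> V 1%g ->
  somewhere_dense (local_orbit lamp_act x U V).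
Proof.
move=> /open_mdist oU /oU[e e0 eU] /open_mdist oV /oV[d d0 dV].
exists x; apply/nbhs_mdist; exists e => // y xy.
apply/closure_mdist => r r0.
have [|s sP] := @fine_window (r / 2); first lra.
have r20 : 0 < r / 2 by lra.
exists (lamp_act (patch s x y) x); last first.
  by apply: le_lt_trans (patch_near x y r20 sP) _; lra.
pose a j : R := if j \in s then y j - x j else 0.
have [|N aN] := vanishing_scale c1 (patch_subproof s x y) (_ : 0 < d / 2); first lra.
have va : vanishing (@coarse R) (fun j => a j / N.+1%:R).
  by apply: (@vanishing_finite _ _ _ s) => j js; rewrite /a (negbTE js) mul0r.
pose z (i : nat) : X := fun j => x j + i%:R / N.+1%:R * a j.
exists N.+1, (fun=> Lamplighter 0 va), z; split.
- by apply/funext => j; rewrite /z mul0r mul0r addr0.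
- apply/funext => j; rewrite /z divff ?pnatr_eq0// mul1r patchE /a.
  by case: ifP => _; rewrite ?addr0// addrC subrK.
- move=> i iN; apply: eU; apply: le_lt_trans xy.
  apply/mdist_configuration_leP => [|j]; first exact: mdist_ge0.
  have [|] := (@mdist_configuration_leP x y _ (mdist_ge0 _ _)).1 (lexx _) j.
    2: by right.
  move=> xyj; left; apply: le_trans xyj.
  have t0 : 0 <= i%:R / N.+1%:R :> R by rewrite divr_ge0.
  have t1 : i%:R / N.+1%:R <= 1 :> R by rewrite ler_pdivrMr ?ltr0Sn// mul1r ler_nat.
  rewrite /z opprD addrA subrr add0r normrN normrM (ger0_norm t0).
  apply: (@le_trans _ _ `|a j|); first by rewrite ler_piMl.
  by rewrite /a; case: ifP => _; rewrite ?normr0// distrC.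
- move=> i iN; split.
    apply: dV; rewrite mdist_lamplighterE /ldist /= ?eqxx.
    apply: (@le_lt_trans _ _ (d / 2)); last lra.
    apply: le_trans aN; rewrite wdistC le_eqVlt; apply/orP; left; apply/eqP.
    by apply: eq_wdist => j; rewrite /seen /= oppr0 !shift0.
  apply/funext => j; rewrite /lamp_act /z /= shift0.
  by rewrite -[i.+1%:R]natr1; set c := N.+1%:R^-1; ring.
Qed.

Lemma lamp_act_turbulent : turbulent lamp_act.
Proof.
split=> [x|x U V oU Ux oV V1 _]; last exact: local_orbit_somewhere_dense.
by split; [exact: orbit_dense|exact: orbit_meager].
Qed.

(** * Unbalanced pairs *)

(** A neighborhood of 1 only restrains the columns whose coarse weight exceeds
some e, that is, those of index at most k in absolute value. Elsewhere every
finite patch is allowed, and patches approximate y. *)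
Lemma closure_local_translates (V : set G) : open V -> V 1%g ->
  exists k : nat, forall x y,
    (forall j, (absz j.2 <= k)%N -> x j = y j) ->
    closure [set lamp_act v x | v in V] y.
Proof.
move=> /open_mdist oV /oV[e e0 eV].
exists (Num.truncn (e / 2)^-1) => x y xy; apply/closure_mdist => d d0.
have [|s sP] := @fine_window (d / 2); first lra.
have d20 : 0 < d / 2 by lra.
exists (lamp_act (patch s x y) x); last first.
  by apply: le_lt_trans (patch_near x y d20 sP) _; lra.
exists (patch s x y) => //; apply: eV; rewrite mdist_lamplighterE /ldist /= ?eqxx.
apply: (@le_lt_trans _ _ (e / 2)); last lra.
have e20 : 0 < e / 2 by lra.
apply/(wdist_leP c1) => [|j]; first exact: ltW.
rewrite /seen /= oppr0 !shift0 sub0r normrN.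
have [jk|jk] := leqP (absz j.2) (Num.truncn (e / 2)^-1).
  by left; rewrite xy// subrr if_same normr0 ltW.
right; rewrite /coarse -[leRHS]invrK lef_pV2 ?posrE ?invr_gt0 ?ltr0n//.
by apply: le_trans (ltW (truncnS_gt _)) _; rewrite ler_nat add1n ltnS ltnW.
Qed.

(** Agreement of x and y on translates of arbitrarily large bands of columns
suffices: move such a band to the center, so that it covers both the columns
restrained by V and the sites that decide membership in U, then patch these
sites with the values of a point of U. The same group element serves for x
and y. *)
Lemma unbalanced_of_agree x y :
  (forall k : nat, exists s : int, forall j, (absz j.2 <= k)%N ->
    x (shift s j) = y (shift s j)) ->
  rel_unbalanced lamp_act x y.
Proof.
move=> agree V U oV V1 /open_mdist oU hU.
have [c Uc] : exists c, U c by case: hU => -[c [Uc _]]; exists c.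
have [e e0 eU] := oU c Uc.
have [k kV] := closure_local_translates oV V1.
have e20 : 0 < e / 2 by lra.
have [w wP] := fine_window e20.
have [m wm] := seq_bound w (fun j => absz j.2).
have [s sP] := agree (maxn k m).
pose t : G := Lamplighter s (vanishing0 (@coarse R)).
pose g : G := (patch w (lamp_act t x) c * t)%g.
have gx j : lamp_act g x j = if j \in w then c j else x (shift s j).
  rewrite /g (lamp_act_left.2) patchE /lamp_act /=.
  by rewrite add0r.
have gy j : lamp_act g y j = if j \in w then c j else y (shift s j).
  rewrite {1}/lamp_act /= !add0r addr0; case: ifPn => [/wm jw|_].
    by rewrite /lamp_act /= add0r sP ?subrK// (leq_trans jw) ?leq_maxr.
  by rewrite add0r.
have gU z : (forall j, j \in w -> z j = c j) -> U z.
  move=> zc; apply: eU; apply: (@le_lt_trans _ _ (e / 2)); last lra.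
  apply/mdist_configuration_leP => [|j]; first exact: ltW.
  have [/zc ->|/wP] := boolP (j \in w); last by right.
  by left; rewrite subrr normr0 ltW.
have gxy j : (absz j.2 <= k)%N -> lamp_act g x j = lamp_act g y j.
  by move=> jk; rewrite gx gy sP// (leq_trans jk) ?leq_maxl.
exists g, g; split.
- by apply: gU => j jw; rewrite gx jw.
- by apply: gU => j jw; rewrite gy jw.
- exact: kV.
- by apply: kV => j jk; rewrite gxy.
Qed.

Definition mix l x : X := fun j => if 0 <= j.2 then x j else l j.

Lemma unbalanced_right x y : (forall j, 0 <= j.2 -> x j = y j) ->
  rel_unbalanced lamp_act x y.
Proof.
move=> xy; apply: unbalanced_of_agree => k; exists (- k%:Z) => j jk.
by apply: xy; rewrite /shift /=; lia.
Qed.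

Lemma unbalanced_left x y : (forall j, j.2 < 0 -> x j = y j) ->
  rel_unbalanced lamp_act x y.
Proof.
move=> xy; apply: unbalanced_of_agree => k; exists (k.+1%:Z) => j jk.
by apply: xy; rewrite /shift /=; lia.
Qed.

Lemma mdist_mix l l' x x' (e : R) : mdist l l' <= e -> mdist x x' <= e ->
  mdist (mix l x) (mix l' x') <= e.
Proof.
move=> ll' xx'; have e0 : 0 <= e by apply: le_trans xx'; exact: mdist_ge0.
apply/mdist_configuration_leP => // j; rewrite /mix.
case: ifP => _; last exact: (mdist_configuration_leP _ _ e0).1 ll' j.
exact: (mdist_configuration_leP _ _ e0).1 xx' j.
Qed.

(** * Generic semi-connectedness *)

Section GenericMixing.
Context (U : set X).
Hypotheses (oU : open U) (dU : dense U).

(** The points x whose section of U, that is, the set of l with mix l x in U,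
meets a basic ball: its center is the rational point p.1 and its radius
1/(p.2+1). *)
Definition mixable (p : seq (site * rat) * nat) : set X := [set x |
  exists2 l : X, mdist (finite_rational R p.1 : X) l < p.2.+1%:R^-1 & U (mix l x)].

Lemma mixable_open p : open (mixable p).
Proof.
apply/open_mdist => x [l pl /((open_mdist U).1 oU)[e e0 eU]].
exists (e / 2) => [|y xy]; first lra.
exists l => //; apply: eU; apply: (@le_lt_trans _ _ (e / 2)); last lra.
by apply: mdist_mix; [rewrite mdistxx; lra|exact: ltW].
Qed.

(** A point u of U close to mix q x gives at once a left half close to q and a
right half close to x. *)
Lemma mixable_dense p : dense (mixable p).
Proof.
apply/dense_mdist => x e e0; pose q : X := finite_rational R p.1.
pose d := Num.min e (p.2.+1%:R^-1).
have d0 : 0 < d by rewrite lt_min e0 invr_gt0 ltr0Sn.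
have [u Uu xu] := (dense_mdist U).1 dU (mix q x) d d0.
have de : d <= e by rewrite ge_min lexx.
have dp : d <= p.2.+1%:R^-1 by rewrite ge_min lexx orbT.
exists (mix x u).
  exists (mix u q).
    apply: lt_le_trans dp; apply: le_lt_trans xu.
    apply/mdist_configuration_leP => [|j]; first exact: mdist_ge0.
    have := (@mdist_configuration_leP (mix q x) u _ (mdist_ge0 _ _)).1 (lexx _) j.
    rewrite /mix; case: ifP => // _ _.
    by left; rewrite subrr normr0 mdist_ge0.
  suff -> : mix (mix u q) (mix x u) = u by [].
  by apply/funext => j; rewrite /mix; case: (0 <= j.2).
apply: lt_le_trans de; apply: le_lt_trans xu.
apply/mdist_configuration_leP => [|j]; first exact: mdist_ge0.
have := (@mdist_configuration_leP (mix q x) u _ (mdist_ge0 _ _)).1 (lexx _) j.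
rewrite /mix; case: ifP => // _ _.
by left; rewrite subrr normr0 mdist_ge0.
Qed.

Lemma mixable_section x : (forall p, mixable p x) ->
  open [set l | U (mix l x)] /\ dense [set l | U (mix l x)].
Proof.
move=> hx; split.
  apply/open_mdist => l /= /((open_mdist U).1 oU)[e e0 eU].
  exists (e / 2) => [|l' ll']; first lra.
  apply: eU; apply: (@le_lt_trans _ _ (e / 2)); last lra.
  by apply: mdist_mix; [exact: ltW|rewrite mdistxx; lra].
apply/dense_mdist => l e e0; have e20 : 0 < e / 2 by lra.
have [q lq] := finite_rational_dense_fine l e20.
have [m me] := inv_succ_lt e20.
have [l' /= ql' Ul'] := hx (q, m); exists l' => //.
apply: le_lt_trans (metric_triangle _ (finite_rational R q : X) _) _.
by rewrite [ltRHS]splitr; exact: ler_ltD lq (lt_trans ql' me).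
Qed.

End GenericMixing.

(** With dense open sets U n whose intersection lies in C, the set D consists of
the x in C at which all sections of the U n are dense: mix l x is then in C for
comeagerly many l. A generic l for both x and y yields the path
x, mix l x, mix l y, y. *)
Lemma lamp_act_semi_connected : generically_semi_connected lamp_act.
Proof.
move=> C _ comC; have [U [odU UC]] := comeager_dense_open comC.
pose D := [set x | C x /\ forall n p, mixable (U n) p x].
exists D; split=> [||x y [Cx Dx] [Cy Dy]]; last 1 first.
- pose S n x := [set l | U n (mix l x)].
  have odS n z : D z -> open (S n z) /\ dense (S n z).
    by move=> [_ /(_ n) hz]; have [oU dU] := odU n; exact: mixable_section.
  (* Even terms of the sequence are sections at x, odd terms sections at y. *)
  have [|l lS] := @Baire_metric R X (fun k => S k./2 (if odd k then y else x)) x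
    configuration_complete.
    by move=> k; apply: odS; case: ifP.
  have lx : C (mix l x).
    by apply: UC => n; have := lS n.*2; rewrite odd_double doubleK.
  have ly : C (mix l y).
    apply: UC => n; have := lS n.*2.+1.
    by rewrite /= odd_double /= uphalf_double.
  exists 3%N, (fun i : nat => match i with
    | 0%N => x | 1%N => mix l x | 2%N => mix l y | _ => y end).
  split=> // [[|[|[|]]]|[|[|[|]]]] // _.
  + by apply: unbalanced_right => j; rewrite /mix => ->.
  + by apply: unbalanced_left => j; rewrite /mix ltNge => /negbTE ->.
  + by apply: unbalanced_right => j; rewrite /mix => ->.
- have [F ndF CF] := comC.
  pose H (i : nat + nat * (seq (site * rat) * nat)) := match i with
    | inl n => F n | inr p => ~` mixable (U p.1) p.2 end.
  apply: (@meagerU_countable X _ H) => [[n|[n p]] /=|].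
  + exact: ndF.
  + have [oU dU] := odU n.
    by apply: nowhere_denseC; [exact: mixable_open|exact: mixable_dense].
  apply/seteqP; split=> [x nD|x [[n|[n p]] _ /=]].
  + have [Cx|nCx] := pselect (C x); last first.
      have : (~` C) x by [].
      by rewrite CF => -[n _ Fx]; exists (inl n).
    apply: contrapT => h; apply: nD; split=> // n p; apply: contrapT => np.
    by apply: h; exists (inr (n, p)).
  + move=> Fx [Cx _]; suff : (~` C) x by [].
    by rewrite CF; exists n.
  + by move=> np [_ /(_ n p)].
- by move=> x [].
Qed.

End Configurations.

(** * The example *)

Theorem corollary1p7 (R : realType) :
  exists (G : topologicalGroupType) (X : topologicalType) (act : G -> X -> X),
    [/\ [set: X] !=set0,
        CLI R G,
        polish_Gspace act R,
        turbulent act &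
        generically_unbalanced act].
Proof.
exists (lamplighter R), (configuration R), (@lamp_act R); split.
- by exists (fun=> 0).
- exact: lamplighter_CLI.
- exact: lamp_act_polish.
- exact: lamp_act_turbulent.
- by split; [exact: orbit_meager|exact: lamp_act_semi_connected].
Qed.
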